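(* For each $N$, the set of rank $N$ Okada arc-diagrams is a sub-semigroup of the semigroup of rank $N$ labelled non-crossing arc-diagrams under the labelled product (that is, the labelled product of two rank $N$ Okada arc-diagrams is a rank $N$ Okada arc-diagram). Furthermore, the rank $N$ Okada arc-diagrams form a monoid whose identity element is $\mathrm{id}_N$.
   Context: Let $[N]=\{1,\dots,N\}$, $\overline{[N]}=\{\bar1,\dots,\bar N\}$, with $|i|=|\bar i|=i$, and totally order $[N]\cup\overline{[N]}$ by $1<2<\dots<N<\bar N<\dots<\bar2<\bar1$. A non-crossing arc-diagram of rank $N$ is a perfect matching of $[N]\cup\overline{[N]}$ (its pairs are called arcs) with no two arcs $\{a,b\},\{c,d\}$ satisfying $a<c<b<d$. An arc $\{a,b\}$ with $a<b$ is nested in $\{c,d\}$ with $c<d$ if $c<a<b<d$. In a labelled non-crossing arc-diagram each arc carries a positive integer label. Labelled product $C\cdot D$: place $C$ to the left of $D$ and identify each node $\bar i$ of $C$ with the node $i$ of $D$. Closed loops are discarded; each remaining path, obtained by concatenating arcs of $C$ and $D$ and joining two nodes among the nodes $[N]$ of $C$ and the nodes $\overline{[N]}$ of $D$, becomes an arc of $C\cdot D$, labelled by the minimum of the labels of the arcs of $C$ and $D$ composing it. This product is associative on labelled non-crossing arc-diagrams. An Okada arc-diagram of rank $N$ is a labelled non-crossing arc-diagram such that: (1) the label of each arc $\{a,b\}$ is at least $1$ and at most $\min(|a|,|b|)$; (2) the label of each arc $\{a,b\}$ has the same parity as $\min(|a|,|b|)$; (3) if an arc is nested in another arc, its label is strictly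 larger than the label of the latter. The diagram $\mathrm{id}_N$ has arcs $\{a,\bar a\}$ labelled $a$ for $1\le a\le N$. *)

(* Defs.v *)
From mathcomp Require Import all_boot.

Set Implicit Arguments.
Unset Strict Implicit.
Unset Printing Implicit Defensive.

Section ArcDiagrams.
Variable N : nat.

(* [inl i] is the node i+1 of [N] and [inr i] is its barred copy. *)
Definition node := ('I_N + 'I_N)%type.

Definition absn (a : node) : nat :=
  match a with inl i => i.+1 | inr i => i.+1 end.

(* 1 < 2 < ... < N < bar N < ... < bar 2 < bar 1 *)
Definition prec (a b : node) : bool :=
  match a, b with
  | inl i, inl j => i < j
  | inl _, inr _ => true
  | inr _, inl _ => false
  | inr i, inr j => j < i
  end.

(* A set of arcs with positive integer labels is encoded by the function that
   sends each arc to its label and every other set of nodes to 0, so that equal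
   labelled diagrams are equal functions. *)
Definition labelling := {ffun {set node} -> nat}.

Definition arcs (C : labelling) : {set {set node}} := [set A | 0 < C A].

Definition perfect_matching (M : {set {set node}}) : Prop :=
  partition M [set: node] /\ (forall A, A \in M -> #|A| = 2).

Definition non_crossing (M : {set {set node}}) : Prop :=
  forall a b c d, [set a; b] \in M -> [set c; d] \in M ->
    ~ [/\ prec a c, prec c b & prec b d].

Definition labelled_arc_diagram (C : labelling) : Prop :=
  perfect_matching (arcs C) /\ non_crossing (arcs C).

(* The arc {a,b}, a < b, is nested in the arc {c,d}, c < d. *)
Definition nested (a b c d : node) : bool := [&& prec c a, prec a b & prec b d].

Definition okada_diagram (C : labelling) : Prop :=
  [/\ labelled_arc_diagram C,
      (forall a b, [set a; b] \in arcs C ->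
         1 <= C [set a; b] <= minn (absn a) (absn b)),
      (forall a b, [set a; b] \in arcs C ->
         odd (C [set a; b]) = odd (minn (absn a) (absn b)))
    & (forall a b c d, [set a; b] \in arcs C -> [set c; d] \in arcs C ->
         nested a b c d -> C [set c; d] < C [set a; b])].

Definition id_diagram : labelling :=
  [ffun A => if [pick i : 'I_N | A == [set inl i; inr i]] is Some i
             then i.+1 else 0].

(* Vertices of the picture obtained by placing C to the left of D: an outer
   node is [inl a], where a unbarred comes from C and a barred comes from D;
   [inr i] is the node [bar i] of C identified with the node [i] of D. *)
Definition vertex := (node + 'I_N)%type.

Definition left_vertex (a : node) : vertex :=
  match a with inl i => inl (inl i) | inr i => inr i end.

Definition right_vertex (a : node) : vertex :=
  match a with inl i => inr i | inr i => inl (inr i) end.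

(* [inl A] is A seen as a possible arc of C, [inr A] as a possible arc of D. *)
Definition edge := ({set node} + {set node})%type.

Definition edge_label (C D : labelling) (e : edge) : nat :=
  match e with inl A => C A | inr A => D A end.

Definition edge_ends (e : edge) : {set vertex} :=
  match e with inl A => left_vertex @: A | inr A => right_vertex @: A end.

Fixpoint walk (C D : labelling) (u : vertex) (p : seq edge) (v : vertex) :
    bool :=
  if p is e :: p' then
    [exists w, [&& 0 < edge_label C D e, edge_ends e == [set u; w]
                 & walk C D w p' v]]
  else u == v.

(* No arc is used twice. In the picture of two perfect matchings outer vertices
   have degree 1 and inner ones degree 2, hence such a walk between two distinct
   outer nodes is the whole path joining them, unique up to reversal. *)
Definition joins (C D : labelling) (a b : node) (p : seq edge) : bool :=
  [&& a != b, uniq p & walk C D (inl a) p (inl b)].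

Definition seq_min (s : seq nat) : nat := foldr minn (head 0 s) s.

(* The bound on the length of p is no restriction, since p has no repetition. *)
Definition labelled_product (C D : labelling) : labelling :=
  [ffun A =>
     if [pick x : node * node * {bseq #|{: edge}| of edge}
          | (A == [set x.1.1; x.1.2]) && joins C D x.1.1 x.1.2 x.2] is Some x
     then seq_min [seq edge_label C D e | e <- x.2]
     else 0].

End ArcDiagrams.

Arguments id_diagram : clear implicits.

Section Semigroups.
Variable T : Type.

Definition semigroup_on (S : T -> Prop) (op : T -> T -> T) : Prop :=
  (forall x y, S x -> S y -> S (op x y)) /\
  (forall x y z, S x -> S y -> S z -> op x (op y z) = op (op x y) z).

Definition subsemigroup (S' S : T -> Prop) (op : T -> T -> T) : Prop :=
  [/\ semigroup_on S op,
      (forall x, S' x -> S x)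
    & (forall x y, S' x -> S' y -> S' (op x y))].

Definition monoid_on (S : T -> Prop) (op : T -> T -> T) (e : T) : Prop :=
  [/\ semigroup_on S op, S e,
      (forall x, S x -> op e x = x)
    & (forall x, S x -> op x e = x)].

End Semigroups.

(* Main.v *)
Require Import Defs.
From mathcomp Require Import all_boot zify.
From Stdlib Require Import Relation_Operators.

(** Write [C D] for the labelled product.  Two descriptions of it carry the
    proof.

    By thresholds.  In the picture of [C D], outer nodes have degree one and
    inner nodes have degree at most two, so the trail leaving an outer node is
    forced at each step, and there is only one ([trail_unique]).  Hence, for
    [k > 0], the arc [{a, b}] has label at least [k] in [C D] if and only if
    [a] and [b] are distinct and connected through arcs of [C] and [D] with
    labels at least [k] ([leq_product]).  A labelling is determined by these
    relations.  Associativity follows: in the picture of three diagrams,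
    replacing the arcs of two consecutive ones by the connections that they
    induce between their outer nodes does not change which of the other nodes
    are connected ([linked_hide], [linked_product]).  The identity laws follow
    too: the arc of [id_diagram] at height [i] has label [i], and an arc of an
    Okada diagram ending at height [i] has label at most [i], so prolonging it
    by that arc of [id_diagram] loses nothing.

    By contractions.  Put the nodes of [C], then those of [D], on a line, each
    in the order [prec].  The node [bar i] of [C] and the node [i] of [D] are
    placed symmetrically around the middle, so gluing them for [i = 1, ..., N]
    in turn identifies each time two points [x < y] that are neighbours among
    the remaining ones.  Each step removes [x] and [y] and joins their partners
    by an arc labelled with the minimum of the two labels ([gluing]), and
    preserves
    - the absence of crossings ([planar_splice]);
    - the rule that nested arcs have larger labels, and the parity of the label,
      which is determined by the position of the left end of the arc
      ([okada_splice]).  If one of the arcs at [x] and [y] is nested in the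
      other, then the minimum is the label of the outer one, and the left ends
      of that arc and of the new arc are at positions of the same parity; if
      not, then both labels have the parity required of the new arc.
    The relations of the first description are preserved as well
    ([linked_splice]), so after [N] steps one reads off from the line both that
    [C D] is a non-crossing perfect matching and that it is an Okada diagram
    when [C] and [D] are ([product_mate]).  The bound on the labels passes to
    [C D] because a minimum is at most the labels at the two ends. *)

Set Implicit Arguments.
Unset Strict Implicit.
Unset Printing Implicit Defensive.

Notation linked := (clos_refl_sym_trans _).

(** * Equivalence closures *)

Lemma linked_map (T U : Type) (r : T -> T -> Prop) (r' : U -> U -> Prop)
    (g : T -> U) u v :
  (forall x y, r x y -> linked r' (g x) (g y)) ->
  linked r u v -> linked r' (g u) (g v).
Proof.
move=> rg; elim=> [x y /rg //|x|x y _ IH|x y z _ IH1 _ IH2].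
- exact: rst_refl.
- exact: rst_sym.
- exact: rst_trans IH1 IH2.
Qed.

Lemma linked_inj (T U : Type) (r : T -> T -> Prop) (r' : U -> U -> Prop)
    (g : T -> U) u v :
  injective g ->
  (forall x y, r' x y -> exists a b, [/\ x = g a, y = g b & r a b]) ->
  linked r' (g u) (g v) -> linked r u v.
Proof.
move=> g_inj rg.
suff H x y : linked r' x y ->
    x = y \/ exists a b, [/\ x = g a, y = g b & linked r a b].
  case/H=> [/g_inj-> | [a [b [/g_inj-> /g_inj-> //]]]]; exact: rst_refl.
elim=> {x y} [x y /rg[a [b [-> -> rab]]]|x|x y _ [->|[a [b [-> -> rab]]]]|].
- by right; exists a, b; split=> //; apply: rst_step.
- by left.
- by left.
- by right; exists b, a; split=> //; apply: rst_sym.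
move=> x y z _ [->|[a [b [-> -> rab]]]] _ [<-|[c [d [e -> rcd]]]].
- by left.
- by right; exists c, d.
- by right; exists a, b.
- right; exists a, d; split=> //; move/g_inj: e rcd => <-; exact: rst_trans.
Qed.

Lemma linked_support (T : Type) (P : T -> Prop) (r : T -> T -> Prop) u v :
  (forall x y, r x y -> P x /\ P y) -> linked r u v -> u = v \/ P u /\ P v.
Proof.
move=> rP; elim=> [x y /rP|x|x y _ IH|x y z _ IH1 _ IH2].
- by right.
- by left.
- by case: IH => [->|[]]; [left|right].
by case: IH1 IH2 => [->|[Px Py]] // [<-|[]]; right.
Qed.

Lemma linked_sub (T : Type) (r r' : T -> T -> Prop) u v :
  (forall x y, r x y -> linked r' x y) -> linked r u v -> linked r' u v.
Proof. exact: (@linked_map T T r r' id). Qed.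

(** A chain between points of [O] only leaves [O] along steps of [B], so each of
    its excursions outside [O] is summed up by [H].  This is the reason why
    gluing diagrams is associative: [O] is the set of nodes still visible once
    the pieces related by [B] have been glued together. *)
Lemma linked_hide (T : Type) (O : T -> Prop) (A B H : T -> T -> Prop) u v :
  (forall x y, A x y -> O x /\ O y) ->
  (forall x y, H x y -> linked B x y) ->
  (forall x y, O x -> O y -> linked B x y -> linked H x y) ->
  O u -> O v ->
  linked (union _ A H) u v <-> linked (union _ A B) u v.
Proof.
move=> AO HB BH Ou Ov; split.
  apply: linked_sub => x y [Axy|/HB].
    by apply: rst_step; left.
  by apply: linked_sub => a b Bab; apply: rst_step; right.
have HAH x y : linked H x y -> linked (union _ A H) x y.
  by apply: linked_sub => a b Hab; apply: rst_step; right.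
(* The class of a hidden point [w] is that of the visible points that [B]
   connects to [w]; it is constant along the steps of [A] and of [B]. *)
pose K w z := exists a, [/\ O a, linked B a w & linked (union _ A H) a z].
have KA x y z : O x -> O y -> linked (union _ A H) x y -> K x z -> K y z.
  move=> Ox Oy xy [a [Oa aBx az]]; exists y; split=> //; first exact: rst_refl.
  apply: rst_trans az; apply: rst_sym; apply: rst_trans xy.
  exact/HAH/BH.
have KB x y z : linked B x y -> K x z -> K y z.
  move=> xy [a [Oa aBx az]]; exists a; split=> //; exact: rst_trans xy.
have Kuv x y : linked (union _ A B) x y -> forall z, K x z <-> K y z.
  elim=> {x y} [x y [Axy|Bxy] z|x z //|x y _ IH z|x y z _ IH1 _ IH2 w].
  - have [Ox Oy] := AO _ _ Axy.
    have xy : linked (union _ A H) x y by apply: rst_step; left.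
    split; [exact: KA|apply: KA => //; exact: rst_sym].
  - have xy : linked B x y by apply: rst_step.
    split; [exact: KB|apply: KB; exact: rst_sym].
  - by rewrite IH.
  - by rewrite IH1.
move=> /Kuv/(_ u)[+ _].
case=> [|a [Oa aBv au]]; first by exists u; split; by [|apply: rst_refl].
by apply: rst_trans (rst_sym _ _ _ _ au) _; exact/HAH/BH.
Qed.

Lemma linked_eq (T : Type) (r r' : T -> T -> Prop) u v :
  (forall x y, r x y <-> r' x y) -> linked r u v <-> linked r' u v.
Proof.
by move=> H; split; apply: linked_sub => x y /H; apply: rst_step.
Qed.

(** * Contracting two neighbouring points of a planar matching *)

Section Planar.
Variables (T : eqType) (pos : T -> nat).
Hypothesis pos_inj : injective pos.

(** For [q] distinct from [p] and [f p], this says that [q] lies strictly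
    between [p] and [f p], whichever of the two comes first. *)
Definition between (f : T -> T) (p q : T) : bool :=
  (pos p < pos q) (+) (pos (f p) < pos q).

(** The points of [live] are matched by [f]; the arc at [p] is labelled [l p].
    The arcs at [p] and [q] cross if and only if exactly one end of the second
    lies between the ends of the first.  Written with exclusive disjunctions,
    the absence of crossings is a linear condition on the comparisons of ends,
    which makes it stable under contraction by mere cancellation. *)
Record planar (live : pred T) (f : T -> T) (l : T -> nat) : Prop := Planar {
  planar_live : forall p, live p -> live (f p);
  planar_inv : forall p, live p -> f (f p) = p;
  planar_neq : forall p, live p -> f p != p;
  planar_label : forall p, live p -> l (f p) = l p;
  planar_gt0 : forall p, live p -> 0 < l p;
  planar_nc : forall p q, live p -> live q -> q != p -> q != f p ->
    between f p q = between f p (f q) }.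

(** In a planar matching an arc with one end between [p] and [f p] has both ends
    there, so [okada_nest] is the nesting rule.  The parity of a
    label is opposite to that of the position of the left end of the arc, and is
    that of the position of the right end; demanding both makes the two ends
    alternate in parity ([okada_alternate]). *)
Record okada_labels (live : pred T) (f : T -> T) (l : T -> nat) : Prop :=
  OkadaLabels {
  okada_nest : forall p q, live p -> live q -> q != p -> q != f p ->
    between f p q -> l p < l q;
  okada_parity : forall p, live p ->
    odd (l p) = odd (pos p) (+) (pos p < pos (f p)) }.

Lemma okada_alternate live f l p : planar live f l -> okada_labels live f l ->
  live p -> odd (pos (f p)) = ~~ odd (pos p).
Proof.
move=> Pf Ol Lp; have Lfp := planar_live Pf Lp.
have := okada_parity Ol Lfp; rewrite (planar_label Pf Lp) (planar_inv Pf Lp).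
rewrite (okada_parity Ol Lp).
have : pos (f p) != pos p by rewrite (inj_eq pos_inj) (planar_neq Pf).
lia.
Qed.

Definition strand (live : pred T) (f : T -> T) (l : T -> nat) k (u v : T) :=
  [/\ live u, v = f u & k <= l u].

Section Contraction.
Variables (live live' : pred T) (f : T -> T) (l : T -> nat) (x y : T).
Hypotheses (Pf : planar live f l) (Lx : live x) (Ly : live y).
Hypothesis lt_xy : pos x < pos y.
Hypothesis adj_xy : forall z, live z -> z != x -> z != y ->
  (pos x < pos z) = (pos y < pos z).
Hypothesis odd_xy : odd (pos y) = ~~ odd (pos x).
Hypothesis live'E : forall z, live' z = [&& live z, z != x & z != y].

(** When [x] and [y] are matched together, their arc becomes a closed loop and
    is discarded: the first two branches are then reached only at [x] and [y],
    which are no longer live. *)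
Definition splice p :=
  if p == f x then f y else if p == f y then f x else f p.
Definition splice_label p :=
  if (p == f x) || (p == f y) then minn (l x) (l y) else l p.

Variant splice_spec p : T -> nat -> Prop :=
| SpliceL of p = f x & f x != y & f y != x & p != f y
   : splice_spec p (f y) (minn (l x) (l y))
| SpliceR of p = f y & f x != y & f y != x & p != f x
   : splice_spec p (f x) (minn (l x) (l y))
| SpliceN of p != f x & p != f y & f p != x & f p != y
   : splice_spec p (f p) (l p).

Let fK := planar_inv Pf.

Lemma neq_xy : x != y.
Proof. by apply: contraTneq lt_xy => ->; rewrite ltnn. Qed.

Lemma partner_eq p q : live p -> live q -> (f p == q) = (p == f q).
Proof.
by move=> Lp Lq; apply/eqP/eqP => [<-|->]; rewrite fK.
Qed.

Lemma partner_inj_eq p q : live p -> live q -> (f p == f q) = (p == q).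
Proof. by move=> Lp Lq; rewrite partner_eq ?fK //; apply: (planar_live Pf). Qed.

Lemma spliceP p : live' p -> splice_spec p (splice p) (splice_label p).
Proof.
rewrite live'E /splice /splice_label => /and3P[Lp px py].
have [Ep|Np1] /= := eqVneq p (f x).
  have fxy : f x != y by rewrite -Ep.
  constructor=> //; first by rewrite partner_eq // eq_sym.
  by rewrite Ep partner_inj_eq ?neq_xy.
have [Ep|Np2] /= := eqVneq p (f y).
  have fyx : f y != x by rewrite -Ep.
  by constructor=> //; rewrite partner_eq // eq_sym.
by constructor; rewrite // partner_eq.
Qed.

Lemma live'W p : live' p -> live p.
Proof. by rewrite live'E => /andP[]. Qed.

Lemma adj_live' p : live' p -> (pos x < pos p) = (pos y < pos p).
Proof. by rewrite live'E => /and3P[*]; apply: adj_xy. Qed.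

Lemma splice_live p : live' p -> live' (splice p).
Proof.
have Lfx := planar_live Pf Lx; have Lfy := planar_live Pf Ly.
move=> L'p; case: (spliceP L'p) => [_ _ fyx _|_ fxy _ _|_ _ fpx fpy].
- by rewrite live'E Lfy fyx (planar_neq Pf).
- by rewrite live'E Lfx fxy (planar_neq Pf).
- by rewrite live'E (planar_live Pf (live'W L'p)) fpx.
Qed.

Lemma between_ends q : live' q -> q != f x -> q != f y ->
  between f x q = between f x (f q) /\ between f y q = between f y (f q).
Proof.
move=> L'q qx qy; move: (L'q); rewrite live'E => /and3P[Lq qnx qny].
by split; apply: (planar_nc Pf).
Qed.

(** Neighbouring points lie on the same side of every arc that avoids them,
    hence so do their partners. *)
Lemma between_xy p : live' p -> p != f x -> p != f y ->
  [/\ between f p (f x) = between f p x, between f p (f y) = between f p y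
    & between f p x = between f p y].
Proof.
move=> L'p px py; move: (L'p); rewrite live'E => /and3P[Lp pnx pny].
have Lfp := planar_live Pf Lp.
rewrite -!(planar_nc Pf Lp) // 1?eq_sym ?partner_eq // 1?eq_sym //.
split=> //; rewrite /between.
suff H q : live q -> q != x -> q != y -> (pos q < pos x) = (pos q < pos y).
  by rewrite !H // partner_eq.
move=> Lq qx qy.
rewrite ltn_neqAle [RHS]ltn_neqAle !(inj_eq pos_inj) qx qy /=.
by rewrite leqNgt adj_xy // -leqNgt.
Qed.

(* Identities between exclusive disjunctions of comparisons hold whatever the
   truth values of the comparisons. *)
Ltac xor_cases :=
  repeat match goal with |- context [?a < ?b] => case: (a < b) end.

Lemma planar_splice : planar live' splice splice_label.
Proof.
have nxy := neq_xy; have nyx : y != x by rewrite eq_sym.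
split; first exact: splice_live.
- move=> p L'p; have := L'p; rewrite live'E => /and3P[Lp pnx pny].
  case: (spliceP L'p) => [-> _ _ _|-> _ _ _|_ _ _ _]; rewrite /splice.
  + by rewrite partner_inj_eq // (negPf nyx) eqxx.
  + by rewrite eqxx.
  + by rewrite !partner_inj_eq // (negPf pnx) (negPf pny) fK.
- move=> p L'p; have Lp := live'W L'p.
  case: (spliceP L'p) => [-> _ _ _|-> _ _ _|_ _ _ _].
  + by rewrite partner_inj_eq.
  + by rewrite partner_inj_eq // neq_xy.
  + exact: (planar_neq Pf).
- move=> p L'p; have := L'p; rewrite live'E => /and3P[Lp pnx pny].
  case: (spliceP L'p) => [_ _ _ _|_ _ _ _|_ _ _ _]; rewrite /splice_label.
  + by rewrite eqxx orbT.
  + by rewrite eqxx.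
  + by rewrite !partner_inj_eq // (negPf pnx) (negPf pny) (planar_label Pf).
- move=> p L'p; have Lp := live'W L'p.
  have := planar_gt0 Pf Lx; have := planar_gt0 Pf Ly.
  have := planar_gt0 Pf Lp.
  by case: (spliceP L'p) => *; rewrite // leq_min; apply/andP.
move=> p q L'p L'q; have Lp := live'W L'p; have Lq := live'W L'q.
have Aq := adj_live' L'q.
have Asq := adj_live' (splice_live L'q).
rewrite {1 2}/between.
case: (spliceP L'p) => [-> _ _ _|-> _ _ _|px py _ _] qp qfp.
- have [] := between_ends L'q qp qfp; move: Aq Asq; rewrite /between.
  case: (spliceP L'q) qp qfp => [->|->|_ _ _ _ _ _]; rewrite ?eqxx //.
  by xor_cases.
- have [] := between_ends L'q qfp qp; move: Aq Asq; rewrite /between.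
  case: (spliceP L'q) qp qfp => [->|->|_ _ _ _ _ _]; rewrite ?eqxx //.
  by xor_cases.
- have [] := between_xy L'p px py; rewrite /between.
  case: (spliceP L'q) qp qfp => [-> _ _ _|-> _ _ _|_ _ _ _] qp qfp.
  + by xor_cases.
  + by xor_cases.
  + move=> _ _ _; exact: (planar_nc Pf).
Qed.

Lemma okada_splice :
  okada_labels live f l -> okada_labels live' splice splice_label.
Proof.
move=> Of; have nest := okada_nest Of.
have nyx : y != x by rewrite eq_sym neq_xy.
have Lfx := planar_live Pf Lx; have Lfy := planar_live Pf Ly.
have altx := okada_alternate Pf Of Lx.
have alty := okada_alternate Pf Of Ly.
split.
  move=> p q L'p L'q; move: (L'q); rewrite live'E => /and3P[Lq qnx qny].
  have Lp := live'W L'p; have Aq := adj_live' L'q.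
  (* A point between the ends of the new arc is between the ends of exactly one
     of the two arcs that it replaces. *)
  have nest_xy : q != f x -> q != f y ->
      (pos (f x) < pos q) (+) (pos (f y) < pos q) -> minn (l x) (l y) < l q.
    move=> qfx qfy b_q; rewrite gtn_min.
    have /orP[/(nest _ _ Lx Lq qnx qfx)->|] //: between f x q || between f y q.
      by move: b_q; rewrite /between Aq; xor_cases.
    by move/(nest _ _ Ly Lq qny qfy)->; rewrite orbT.
  rewrite {1}/between.
  case: (spliceP L'p) => [-> _ _ _|-> _ _ _|px py _ _] qp qfp.
  - case: (spliceP L'q) qp qfp => [-> _ _ _|-> _ _ _|_ _ _ _]; rewrite ?eqxx //.
  - case: (spliceP L'q) qp qfp => [-> _ _ _|-> _ _ _|_ _ _ _]; rewrite ?eqxx //.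
    move=> qp qfp.
    by rewrite addbC; apply: nest_xy.
  - have [bfx bfy bxy] := between_xy L'p px py.
    have nest_p z : live z -> p != z -> p != f z -> between f p z -> l p < l z.
      move=> Lz pz pfz; apply: nest; rewrite // eq_sym ?partner_eq //.
    move: L'p; rewrite live'E => /and3P[_ pnx pny].
    case: (spliceP L'q) qp qfp => [-> _ _ _|-> _ _ _|_ _ _ _] qp qfp.
    + move=> b; have {}b : between f p x by rewrite -bfx.
      by rewrite leq_min !nest_p // -bxy.
    + move=> b; have {}b : between f p x by rewrite bxy -bfy.
      by rewrite leq_min !nest_p // -bxy.
    + exact: nest.
have odd_f : odd (pos (f x)) = ~~ odd (pos (f y)).
  by rewrite altx alty odd_xy !negbK.
have parity_xy : f x != y ->
    odd (minn (l x) (l y)) = odd (pos (f x)) (+) (pos (f x) < pos (f y)).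
  move=> fxy; have fyx : f y != x by rewrite partner_eq // eq_sym.
  have ncx := planar_nc Pf Lx Ly nyx; have ncy := planar_nc Pf Ly Lx neq_xy.
  have nestx := nest x y Lx Ly nyx; have nesty := nest y x Ly Lx neq_xy.
  rewrite ![_ == f _]eq_sym in ncx ncy nestx nesty.
  have {ncx} := ncx fxy; have {ncy} := ncy fyx.
  have {nestx} := nestx fxy; have {nesty} := nesty fyx.
  have := okada_parity Of Lx; have := okada_parity Of Ly.
  have := adj_xy Lfx (planar_neq Pf Lx) fxy.
  have := adj_xy Lfy fyx (planar_neq Pf Ly).
  have -> : odd (pos y) = odd (pos (f x)) by rewrite altx odd_xy.
  have -> : odd (pos x) = ~~ odd (pos (f x)) by rewrite altx negbK.
  have lt_yx : (pos y < pos x) = false by rewrite ltnNge ltnW.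
  rewrite /between lt_xy lt_yx /=.
  (* Either [y < f y < f x], with the arc at [y] nested in that at [x], or
     [f x < x < y < f y], or [f y < f x < x], with the arc at [x] nested in that
     at [y]. *)
  have [lt_xfx|le_fxx] := ltnP (pos x) (pos (f x)).
    move=> _ /esym lt_yfx _ odd_lx _.
    have -> /= : (pos (f x) < pos y) = false by rewrite ltnNge ltnW.
    move=> lt_l _ ncx; rewrite (minn_idPl (ltnW (lt_l isT))) odd_lx.
    rewrite addbT negbK; have [lt_ff|] := ltnP; last by rewrite addbF.
    by rewrite lt_ff (ltn_trans lt_xfx lt_ff) in ncx.
  rewrite (leq_ltn_trans le_fxx lt_xy) /= !addbF.
  have [lt_yfy _|le_fyy] := ltnP (pos y) (pos (f y)).
    rewrite addbT => _ odd_ly odd_lx _ _ _ _.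
    rewrite (ltn_trans (leq_ltn_trans le_fxx lt_xy) lt_yfy) addbT.
    by rewrite /minn; case: ifP.
  move=> nlt_xfy <- odd_ly _ lt_l _.
  have lt_fyx : pos (f y) < pos x.
    by rewrite ltn_neqAle (inj_eq pos_inj) fyx leqNgt nlt_xfy.
  rewrite (minn_idPr (ltnW (lt_l lt_fyx))) lt_fyx odd_ly => /= /esym lt_fyfx _.
  by congr (_ (+) _); rewrite ltnNge ltnW.
move=> p L'p; have := okada_parity Of (live'W L'p).
case: (spliceP L'p) => [-> fxy _ _ _|-> fxy _ _ _|_ _ _ _ //].
  by rewrite parity_xy.
rewrite parity_xy //.
rewrite odd_f addNb -addbN; congr (_ (+) _).
by rewrite -leqNgt ltn_neqAle (inj_eq pos_inj) partner_inj_eq ?nyx.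
Qed.

(** Once [x] and [y] are identified, they can be reached only through their
    partners: collapsing both onto a partner whose arc survives at threshold
    [k], if there is one, turns a chain through [x] and [y] into a chain that
    avoids them. *)
Lemma linked_splice k (glue glue' : T -> T -> Prop) p q :
  (forall u v, glue u v <-> glue' u v \/ u = x /\ v = y) ->
  (forall u v, glue' u v -> [/\ u != x, u != y, v != x & v != y]) ->
  live' p -> live' q ->
  linked (union _ (strand live f l k) glue) p q <->
  linked (union _ (strand live' splice splice_label k) glue') p q.
Proof.
move=> glueE glue'N L'p L'q; split; last first.
  have step u : live u -> k <= l u ->
      linked (union _ (strand live f l k) glue) u (f u).
    by move=> Lu klu; apply: rst_step; left.
  have xy : linked (union _ (strand live f l k) glue) x y.
    by apply: rst_step; right; apply/glueE; right.
  have fxfy : k <= minn (l x) (l y) ->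
      linked (union _ (strand live f l k) glue) (f x) (f y).
    rewrite leq_min => /andP[klx kly]; apply: rst_trans (step _ Ly kly).
    by apply: rst_trans xy; apply: rst_sym; apply: step.
  apply: linked_sub => u v [[L'u -> ]|g'uv]; last first.
    by apply: rst_step; right; apply/glueE; left.
  case: (spliceP L'u) => [-> _ _ _|-> _ _ _|_ _ _ _ klu].
  - exact: fxfy.
  - by move=> klu; apply/rst_sym/fxfy.
  - exact/step/klu/live'W.
(* The image of [x] and [y] under the collapsing map [g]; if no arc at [x] or
   [y] leaves the pair, then the two points are isolated and [c = x] serves. *)
pose c := if (k <= l x) && (f x != y) then f x
  else if (k <= l y) && (f y != x) then f y else x.
pose g u := if (u == x) || (u == y) then c else u.
have gx : g x = c by rewrite /g eqxx.
have gy : g y = c by rewrite /g eqxx orbT.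
have gN u : u != x -> u != y -> g u = u.
  by rewrite /g => /negPf-> /negPf->.
have [pnx pny qnx qny] : [/\ p != x, p != y, q != x & q != y].
  by move: L'p L'q; rewrite !live'E => /and3P[_ -> ->] /and3P[_ -> ->].
rewrite -[p in X in _ -> X]gN // -[q in X in _ -> X]gN //.
set r' := (X in _ -> linked X _ _).
have fxx := planar_neq Pf Lx; have fyy := planar_neq Pf Ly.
have nyx : y != x by rewrite eq_sym neq_xy.
have link_x : k <= l x -> linked r' (g (f x)) c.
  move=> klx; have [->|fxy] := eqVneq (f x) y.
    by rewrite gy; apply: rst_refl.
  by rewrite gN // /c klx fxy; apply: rst_refl.
have link_y : k <= l y -> linked r' (g (f y)) c.
  move=> kly; have [->|fyx] := eqVneq (f y) x.
    by rewrite gx; apply: rst_refl.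
  have fxy : f x != y by rewrite partner_eq // eq_sym.
  rewrite gN // /c fxy fyx kly !andbT /=.
  case: (leqP k (l x)) => [klx|_]; last exact: rst_refl.
  apply/rst_sym/rst_step; left; split.
  - by rewrite live'E (planar_live Pf Lx) fxx.
  - by rewrite /splice eqxx.
  - by rewrite /splice_label eqxx leq_min klx.
apply: linked_map => u v [[Lu -> klu]|/glueE[g'uv|[-> ->]]]; last 2 first.
- have [ux uy vx vy] := glue'N _ _ g'uv.
  by rewrite !gN //; apply: rst_step; right.
- by rewrite gx gy; apply: rst_refl.
have [Eu|ux] := eqVneq u x.
  by rewrite Eu gx in klu *; apply/rst_sym/link_x.
have [Eu|uy] := eqVneq u y.
  by rewrite Eu gy in klu *; apply/rst_sym/link_y.
have [Eu|fux] := eqVneq (f u) x.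
  by rewrite Eu gx -(fK Lu) Eu; apply: link_x; rewrite -Eu (planar_label Pf).
have [Eu|fuy] := eqVneq (f u) y.
  by rewrite Eu gy -(fK Lu) Eu; apply: link_y; rewrite -Eu (planar_label Pf).
rewrite !gN //; apply: rst_step; left.
rewrite partner_eq // in fux; rewrite partner_eq // in fuy.
rewrite /strand /splice /splice_label (negPf fux) (negPf fuy).
by rewrite live'E Lu ux uy.
Qed.
End Contraction.
End Planar.

(** * Diagrams as planar matchings of a line *)

Lemma set2_injr (T : finType) (a b c : T) : [set a; b] = [set a; c] -> b = c.
Proof.
move=> E; have := set22 a c; have := set22 a b; rewrite E -{2}E !inE.
by case/orP=> /eqP ? /orP[]/eqP ?; congruence.
Qed.

Section Nodes.
Variable N : nat.
Implicit Types (C D : labelling N) (F G : node N -> node N) (a b : node N).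

(** The rank of a node in the order [prec], counted from [0]. *)
Definition npos a : nat :=
  match a with inl i => i | inr i => N + N - i.+1 end.

Lemma npos_inj : injective npos.
Proof.
by case=> i [] j /= E; have := ltn_ord i; have := ltn_ord j; move=> *;
   try (congr (_ _); apply: ord_inj); lia.
Qed.

Lemma precE a b : prec a b = (npos a < npos b).
Proof.
by case: a b => i [] j //=; have := ltn_ord i; have := ltn_ord j; lia.
Qed.

Record matched_by C F : Prop := MatchedBy {
  mate_inv : involutive F;
  mate_neq : forall a, F a != a;
  mate_gt0 : forall a, 0 < C [set a; F a];
  mate_arc : forall A, 0 < C A -> exists a, A = [set a; F a] }.

Lemma arc_at C F A a : matched_by C F -> 0 < C A -> a \in A -> A = [set a; F a].
Proof.
move=> mC /(mate_arc mC)[b ->]; rewrite !inE => /orP[]/eqP-> //.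
by rewrite (mate_inv mC) setUC.
Qed.

Lemma arc_mate C F a b : matched_by C F -> 0 < C [set a; b] -> b = F a.
Proof. by move=> mC /(arc_at mC)/(_ (set21 a b))/set2_injr. Qed.

Lemma perfect_matchingP C :
  perfect_matching (arcs C) <-> exists F, matched_by C F.
Proof.
split=> [[/and3P[/eqP covC tiC _] card2]|[F mC]].
  pose F a := odflt a [pick b | (b != a) && (0 < C [set a; b])].
  have FP a : F a != a /\ 0 < C [set a; F a].
    rewrite /F; case: pickP => [b /andP[]//|no_b] /=.
    have aC : a \in cover (arcs C) by rewrite covC inE.
    have /[!inE] := pblock_mem aC.
    have a_b : a \in pblock (arcs C) a by rewrite mem_pblock.
    have /eqP/cards2P[x [y [xy E]]] := card2 _ (pblock_mem aC).
    rewrite E !inE in a_b *; case/orP: a_b => /eqP Ea Cxy.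
      by have := no_b y; rewrite Ea eq_sym xy Cxy.
    by have := no_b x; rewrite Ea xy setUC Cxy.
  have Funiq a b : 0 < C [set a; b] -> b = F a.
    move=> Cab; apply: (@set2_injr _ a); have [_ CF] := FP a.
    rewrite -(def_pblock tiC _ (set21 a b)) ?inE //.
    by apply: def_pblock; rewrite ?inE ?eqxx.
  exists F; split=> [a|a|a|A CA]; try by case: (FP a).
    by apply/esym/Funiq; rewrite setUC; case: (FP a).
  have /eqP/cards2P[x [y [xy E]]] : #|A| = 2 by apply: card2; rewrite inE.
  by exists x; rewrite -(Funiq x y) // -E.
split; last first.
  move=> A; rewrite inE => /(mate_arc mC)[a ->].
  by rewrite cards2 eq_sym (mate_neq mC).
apply/and3P; split.
- apply/eqP/setP => a; rewrite inE; apply/bigcupP; exists [set a; F a].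
    by rewrite inE; apply: mate_gt0 mC a.
  by rewrite set21.
- apply/trivIsetP => A B; rewrite !inE => CA CB; apply: contraR => /pred0Pn[a].
  by case/andP=> /(arc_at mC CA)-> /(arc_at mC CB)->.
- rewrite inE; apply/negP => /(mate_arc mC)[a /setP/(_ a)].
  by rewrite !inE eqxx.
Qed.

Definition mate_label C F a := C [set a; F a].
Definition planar_mate C F := planar npos predT F (mate_label C F).
Definition okada_mate C F := okada_labels npos predT F (mate_label C F).

Lemma non_crossingP C F : matched_by C F ->
  non_crossing (arcs C) <-> planar_mate C F.
Proof.
move=> mC; have FK := mate_inv mC; have CF := mate_gt0 mC.
have npos_eq p q : (npos p == npos q) = (p == q) := inj_eq npos_inj p q.
split=> [nc|Pf].
  split=> //.
  - by move=> p _; apply: mate_neq mC p.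
  - by move=> p _; rewrite /mate_label FK setUC.
  - by move=> p _; apply: CF.
  move=> p q _ _ qp qFp.
  have {}nc a b : ~~ (npos a < npos b < npos (F a))
                    || (npos (F b) <= npos (F a)).
    rewrite [npos (F b) <= _]leqNgt -negb_and -!precE.
    apply/negP => /andP[/andP[ab bFa] FaFb].
    by apply: nc (And3 ab bFa FaFb); rewrite inE.
  have Fqp : F q != p by rewrite (can2_eq FK FK).
  have Fqp' : F q != F p by rewrite (can_eq FK).
  move: qp qFp Fqp Fqp'; rewrite -!npos_eq /between.
  have := nc p q; have := nc (F p) q.
  have := nc p (F q); have := nc (F p) (F q).
  have := nc q p; have := nc (F q) p.
  have := nc q (F p); have := nc (F q) (F p).
  rewrite !FK; move: (npos p) (npos q) (npos (F p)) (npos (F q)) => a b c d.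
  by case: (ltnP a b); case: (ltnP c b); case: (ltnP a d);
    case: (ltnP c d) => //; lia.
move=> a b c d; rewrite !inE => /(arc_mate mC)-> /(arc_mate mC)->.
rewrite !precE => -[ac ca ad].
have := @planar_nc _ _ _ _ _ Pf a c isT isT.
rewrite -!npos_eq /between ac (gtn_eqF ac) (ltn_eqF ca) ad.
by rewrite (ltn_trans ac (ltn_trans ca ad)) ltnNge (ltnW ca) => /(_ isT isT).
Qed.

Lemma labelled_arc_diagramP C :
  labelled_arc_diagram C <-> exists2 F, matched_by C F & planar_mate C F.
Proof.
split=> [[/perfect_matchingP[F mC] ncC]|[F mC pC]].
  by exists F; last exact/(non_crossingP mC).
by split; [apply/perfect_matchingP; exists F|apply/(non_crossingP mC)].
Qed.

Lemma npos_onto k : k < N + N -> exists a, npos a = k.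
Proof.
move=> k_lt; have [kN|Nk] := ltnP k N; first by exists (inl (Ordinal kN)).
have k'N : N + N - k.+1 < N by lia.
by exists (inr (Ordinal k'N)) => /=; lia.
Qed.

Lemma npos_lt a : npos a < N + N.
Proof. by case: a => i /=; have := ltn_ord i; lia. Qed.

(** The points strictly inside an arc are matched among themselves, so there is
    an even number of them. *)
Lemma planar_alternate F l a : planar npos predT F l ->
  odd (npos (F a)) = ~~ odd (npos a).
Proof.
move=> Pf; have FK b := planar_inv Pf (erefl : predT b).
have F_eq b c : (npos (F b) == npos (F c)) = (npos b == npos c).
  by rewrite !(inj_eq npos_inj) (can_eq FK).
have F_eq' b c : (npos (F b) == npos c) = (npos b == npos (F c)).
  by rewrite !(inj_eq npos_inj) (can2_eq FK FK).
have F_neq b : npos (F b) != npos b.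
  by rewrite (inj_eq npos_inj) (planar_neq Pf).
have sep b c : npos c != npos b -> npos c != npos (F b) ->
    between npos F b c = between npos F b (F c).
  by rewrite !(inj_eq npos_inj); apply: (planar_nc Pf).
(* An interval stable under the matching has even length: cut it at the arc of
   its first point. *)
have even_closed n lo hi : hi - lo <= n -> lo <= hi -> hi <= N + N ->
    (forall b, lo <= npos b < hi -> lo <= npos (F b) < hi) ->
    odd hi = odd lo.
  elim: n lo hi => [|n IH] lo hi size_le le_lh le_h closed.
    by congr odd; lia.
  have [-> //|neq_lh] := eqVneq lo hi.
  have lt_lh : lo < hi by lia.
  have [b Eb] : exists b, npos b = lo by apply: npos_onto; lia.
  have /andP[lFb Fbh] : lo <= npos (F b) < hi by apply: closed; rewrite Eb; lia.
  have bFb := F_neq b.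
  have E1 : odd (npos (F b)) = odd lo.+1.
    apply: IH; [lia|lia|lia|] => c lt_c.
    have := sep b c; have := closed c; have := F_eq c b; have := F_eq' c b.
    rewrite /between; lia.
  have E2 : odd hi = odd (npos (F b)).+1.
    apply: IH; [lia|lia|lia|] => c lt_c.
    have := sep b c; have := closed c; have := F_eq c b; have := F_eq' c b.
    rewrite /between; lia.
  by rewrite E2 /= E1 /= negbK.
wlog lt_a : a / npos a < npos (F a).
  have [aFa|] := ltnP (npos a) (npos (F a)); first by apply.
  rewrite leq_eqVlt (negPf (F_neq a)) /= => lt_a /(_ (F a)).
  by rewrite FK => /(_ lt_a)->; rewrite negbK.
apply: (even_closed (N + N) (npos a).+1); have := npos_lt (F a); try lia.
move=> _ c lt_c.
have := sep a c; have := F_eq c a; have := F_eq' c a; rewrite /between; lia.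
Qed.

(** The rank of the left end of an arc and the smaller of its two heights have
    opposite parities.  This is clear for an arc between unbarred nodes; an arc
    from [i] to [bar j] has [i] and [j] of the same parity; an arc from [bar j]
    to [bar i] has [i] and [j] of opposite parities, with [i < j], and [bar j]
    has rank [2 N - j]. *)
Lemma okada_diagramP C F : matched_by C F -> planar_mate C F ->
  okada_diagram C <-> okada_mate C F /\ forall a, mate_label C F a <= absn a.
Proof.
move=> mC pC; have FK := mate_inv mC; have CF := mate_gt0 mC.
have arcF a : [set a; F a] \in arcs C by rewrite inE.
have CFa a : C [set F a; a] = C [set a; F a] by rewrite setUC.
have npos_eq p q : (npos p == npos q) = (p == q) := inj_eq npos_inj p q.
have parity_min a : odd (npos a) (+) (npos a < npos (F a))
    = odd (minn (absn a) (absn (F a))).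
  have := planar_alternate a pC; have := mate_neq mC a; rewrite -npos_eq.
  case: (a) (F a) => i [] j /=; have := ltn_ord i; have := ltn_ord j;
    rewrite minnSS /minn; case: ifP; lia.
split=> [[_ bd par nest]|[Of bd]].
  split; last first.
    move=> a; have /andP[_] := bd _ _ (arcF a).
    by rewrite leq_min => /andP[].
  split; last by move=> a _; rewrite parity_min; apply: par.
  move=> p q _ _ qp qFp b_pq.
  have nestF x y : npos x < npos y -> npos y < npos (F y) ->
      npos (F y) < npos (F x) -> mate_label C F x < mate_label C F y.
    by move=> xy yFy Fyx; apply: nest; rewrite // /nested !precE xy yFy.
  have := planar_nc pC (erefl : predT p) (erefl : predT q) qp qFp.
  have lF x : mate_label C F (F x) = mate_label C F x by rewrite /mate_label FK.
  have := nestF p q; have := nestF (F p) q.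
  have := nestF p (F q); have := nestF (F p) (F q); rewrite !lF !FK.
  have Fqp : F q != p by rewrite (can2_eq FK FK).
  have FqFp : F q != F p by rewrite (can_eq FK).
  have := mate_neq mC q; move: qp qFp Fqp FqFp b_pq.
  rewrite -!npos_eq /between.
  case: (ltnP (npos p) (npos q)); case: (ltnP (npos (F p)) (npos q)) => //; lia.
split.
- by apply/labelled_arc_diagramP; exists F.
- move=> a b; rewrite inE => Cab; have := bd b; have := bd a.
  by rewrite (arc_mate mC Cab) /mate_label FK CFa leq_min CF => -> ->.
- move=> a b; rewrite inE => Cab; rewrite (arc_mate mC Cab) -parity_min.
  exact: okada_parity Of a isT.
- move=> a b c d; rewrite !inE => Cab Ccd.
  rewrite (arc_mate mC Cab) (arc_mate mC Ccd) /nested !precE.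
  move=> /and3P[ca aFa Fad].
  have a_Fc := ltn_trans aFa Fad.
  have neq_ac : a != c by rewrite -npos_eq gtn_eqF.
  have neq_aFc : a != F c by rewrite -npos_eq ltn_eqF.
  apply: (okada_nest Of) => //.
  by rewrite /between ca [npos (F c) < _]ltnNge ltnW.
Qed.
End Nodes.

(** * The product by thresholds *)

Lemma leq_seq_min k s : s != [::] -> (k <= seq_min s) = all (leq k) s.
Proof.
case: s => // x s _; rewrite /seq_min.
suff -> y : (k <= foldr minn y (x :: s)) = (k <= y) && all (leq k) (x :: s).
  by rewrite /=; case: (k <= x).
by elim: (x :: s) => [|z t IH] /=; rewrite ?andbT // leq_min IH andbCA.
Qed.

Lemma eq_from_leq m n : (forall k, 0 < k -> (k <= m) = (k <= n)) -> m = n.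
Proof.
move=> H; apply/eqP; rewrite eqn_leq; apply/andP; split.
  by case: m H => // m H; rewrite -H.
by case: n H => // n H; rewrite H.
Qed.

Section Picture.
Variables (N : nat) (C D : labelling N).
Implicit Types (e : edge N) (u v w : vertex N) (p q : seq (edge N)).

Lemma left_vertex_inj : injective (@left_vertex N).
Proof. by case=> i [] j //= [->]. Qed.

Lemma right_vertex_inj : injective (@right_vertex N).
Proof. by case=> i [] j //= [->]. Qed.

Definition in_left e : bool := if e is inl _ then true else false.

Definition link k : rel (vertex N) := fun u v =>
  [exists e, (k <= edge_label C D e) && (edge_ends e == [set u; v])].

Lemma walk_consP u v e p :
  reflect (exists w, [/\ 0 < edge_label C D e, edge_ends e = [set u; w]
                      & walk C D w p v])
          (walk C D u (e :: p) v).
Proof.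
apply: (iffP existsP) => [[w /and3P[? /eqP ? ?]]|[w [? E ?]]]; exists w => //.
by apply/and3P; split=> //; apply/eqP.
Qed.

Lemma walk_cat u v w p q :
  walk C D u p v -> walk C D v q w -> walk C D u (p ++ q) w.
Proof.
elim: p u => [|e p IH] u; first by move/eqP->.
case/walk_consP=> x [e_gt0 e_ends /IH xq /xq ?].
by apply/walk_consP; exists x.
Qed.

Lemma walk_rev u v p : walk C D u p v -> walk C D v (rev p) u.
Proof.
elim: p u => [|e p IH] u; first by rewrite /= eq_sym.
case/walk_consP=> w [e_gt0 e_ends /IH vw]; rewrite rev_cons -cats1.
apply: walk_cat vw _; apply/walk_consP; exists u; rewrite e_ends setUC.
by split=> //=; apply/eqP.
Qed.

Lemma joins_rev a b p : joins C D a b p -> joins C D b a (rev p).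
Proof.
by case/and3P=> ab Up /walk_rev Wp; rewrite /joins eq_sym ab rev_uniq Up.
Qed.

Lemma linked_walk k u v p : walk C D u p v ->
  all (fun e => k <= edge_label C D e) p -> linked (link k) u v.
Proof.
elim: p u => [|e p IH] u; first by move/eqP-> => _; apply: rst_refl.
case/walk_consP=> w [_ e_ends /IH Wp] /= /andP[ke /Wp].
apply: rst_trans; apply: rst_step; apply/existsP; exists e.
by rewrite ke e_ends /=.
Qed.

(** A path without repeated vertices is a trail without repeated edges: the
    first edge contains the first vertex, which the next edges avoid. *)
Lemma path_trail k u s : 0 < k -> path (link k) u s -> uniq (u :: s) ->
  exists p, [/\ walk C D u p (last u s), uniq p,
    all (fun e => k <= edge_label C D e) p
    & forall e, e \in p -> edge_ends e \subset u :: s].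
Proof.
move=> k_gt0; elim: s u => [|v s IH] u /=.
  by exists [::]; split=> //=; apply: eqxx.
case/andP=> /existsP[e /andP[ke /eqP e_ends]] vs /andP[u_vs Us].
have [p [Wp Up kp p_sub]] := IH _ vs Us; exists (e :: p); split.
- by apply/walk_consP; exists v; rewrite (leq_trans k_gt0).
- rewrite /= Up andbT; apply: contra u_vs => /p_sub/subsetP; apply.
  by rewrite e_ends set21.
- by rewrite /= ke.
- move=> f; rewrite inE => /predU1P[->|/p_sub/subset_trans]; last apply.
    by rewrite e_ends; apply/subsetP => x; rewrite !inE => /orP[]/eqP->;
       rewrite eqxx ?orbT.
  by apply/subsetP => x; rewrite !inE => ->; rewrite orbT.
Qed.

Lemma linked_trail k a b : 0 < k -> a != b -> linked (link k) (inl a) (inl b) ->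
  exists2 p, joins C D a b p & all (fun e => k <= edge_label C D e) p.
Proof.
move=> k_gt0 ab ab_k.
have link_sym : symmetric (link k).
  by move=> u v; apply: eq_existsb => e; rewrite setUC.
have : connect (link k) (inl a) (inl b).
  elim: ab_k => [u v|u|u v _|u v w _ uv _ vw].
  - exact: connect1.
  - exact: connect0.
  - by rewrite (sym_connect_sym link_sym).
  - exact: connect_trans uv vw.
case/connectP=> s0 path_s0 /esym; case/shortenP: path_s0 => s path_s Us _ Es.
have [p [Wp Up kp _]] := path_trail k_gt0 path_s Us.
by exists p; rewrite // /joins ab Up -Es.
Qed.

Section Unique.
Variables F G : node N -> node N.
Hypotheses (mC : matched_by C F) (mD : matched_by D G).

(** Each diagram contributes at most one edge at each vertex of the picture. *)
Lemma edge_at e f u : 0 < edge_label C D e -> 0 < edge_label C D f ->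
  u \in edge_ends e -> u \in edge_ends f -> in_left e = in_left f -> e = f.
Proof.
case: e f => A [] B //= lA lB /imsetP[a aA ->] /imsetP[b bB].
  by move/left_vertex_inj=> Eb; rewrite -Eb in bB;
     rewrite (arc_at mC lA aA) (arc_at mC lB bB).
by move/right_vertex_inj=> Eb; rewrite -Eb in bB;
   rewrite (arc_at mD lA aA) (arc_at mD lB bB).
Qed.

Lemma outer_side e f a : inl a \in edge_ends e -> inl a \in edge_ends f ->
  in_left e = in_left f.
Proof.
by case: e f => A [] B //= /imsetP[[i|i] _] //= [->] /imsetP[[j|j] _].
Qed.

(** Having entered [u] through [e0], a trail can only leave through the edge of
    the other diagram at [u], and it cannot leave an outer node. *)
Lemma trail_unique_from e0 u a b p q :
  0 < edge_label C D e0 -> u \in edge_ends e0 ->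
  uniq (e0 :: p) -> uniq (e0 :: q) ->
  walk C D u p (inl a) -> walk C D u q (inl b) -> p = q.
Proof.
have stuck e c f r d : 0 < edge_label C D e -> inl c \in edge_ends e ->
    uniq (e :: f :: r) -> walk C D (inl c) (f :: r) d -> False.
  move=> le ce Ue /walk_consP[w [lf f_ends _]].
  have cf : inl c \in edge_ends f by rewrite f_ends set21.
  move: Ue; rewrite (edge_at le lf ce cf (outer_side ce cf)) /=.
  by rewrite inE eqxx.
elim: p q u e0 => [|e p IH] [|f q] u e0 l0 u0 U0p U0q //.
- by move/eqP=> Eu; rewrite Eu in u0 *; move/(stuck _ _ _ _ _ l0 u0 U0q).
- move=> W /eqP Eu; rewrite Eu in u0 W; by case: (stuck _ _ _ _ _ l0 u0 U0p W).
case/walk_consP=> w [le e_ends Wp] /walk_consP[x [lf f_ends Wq]].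
have ue : u \in edge_ends e by rewrite e_ends set21.
have uf : u \in edge_ends f by rewrite f_ends set21.
have Ee : e = f.
  apply: (edge_at le lf ue uf).
  have : in_left e0 != in_left e.
    apply: contraTneq U0p => /(edge_at l0 le u0 ue)->.
    by rewrite /= inE eqxx.
  have : in_left e0 != in_left f.
    apply: contraTneq U0q => /(edge_at l0 lf u0 uf)->.
    by rewrite /= inE eqxx.
  by case: (in_left e0) (in_left e) (in_left f) => [] [] [].
subst f; have Ew : w = x by apply: (@set2_injr _ u); rewrite -e_ends.
subst x; congr (_ :: _); move: U0p U0q => /andP[_ Up] /andP[_ Uq].
by apply: IH Up Uq Wp Wq; rewrite // e_ends set22.
Qed.

Lemma trail_unique a b c p q : joins C D a b p -> joins C D a c q -> p = q.
Proof.
case/and3P=> ab Up Wp /and3P[ac Uq Wq].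
case: p q Up Wp Uq Wq => [|e p] [|f q] Up Wp Uq Wq //.
- by case/eqP: Wp ab => ->; rewrite eqxx.
- by case/eqP: Wq ac => ->; rewrite eqxx.
case/walk_consP: Wp => w [le e_ends Wp].
case/walk_consP: Wq => x [lf f_ends Wq].
have ue : inl a \in edge_ends e by rewrite e_ends set21.
have uf : inl a \in edge_ends f by rewrite f_ends set21.
have Ee := edge_at le lf ue uf (outer_side ue uf).
subst f; have Ew : w = x by apply: (@set2_injr _ (inl a)); rewrite -e_ends.
subst x; congr (_ :: _).
by apply: trail_unique_from le _ Up Uq Wp Wq; rewrite e_ends set22.
Qed.

(** The labelled product at all thresholds at once.  If [a] and [b] are
    connected at threshold [k], then a trail with labels at least [k] joins
    them; as there is no other trail between them up to reversal, the definition
    of the product selects this trail or its reversal. *)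
Lemma leq_product k a b : 0 < k ->
  k <= labelled_product C D [set a; b] <->
  a != b /\ linked (link k) (inl a) (inl b).
Proof.
move=> k_gt0; rewrite ffunE; set P := fun x => _ && _.
have joins_neq0 c d p : joins C D c d p ->
    [seq edge_label C D e | e <- p] != [::].
  by case: p => // /and3P[/negP cd _ /eqP[E]]; case: cd; rewrite E.
split.
  case: pickP => [[[c d] p] /andP[/eqP E J]|_]; last by rewrite leqNgt k_gt0.
  rewrite leq_seq_min ?(joins_neq0 _ _ _ J) // all_map => kp.
  have cd := and3P J; case: cd => cd _ /linked_walk/(_ kp) cd_k.
  have : a \in [set c; d] by rewrite -E set21.
  have Ecard : #|[set a; b]| = 2 by rewrite E cards2 cd.
  have ab : a != b by move: Ecard; rewrite cards2; case: eqP.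
  rewrite !inE => /orP[]/eqP Ea; split=> //.
    by move: E; rewrite Ea => /set2_injr->.
  by move: E; rewrite Ea [RHS]setUC => /set2_injr->; apply: rst_sym.
case=> ab /(linked_trail k_gt0 ab)[p J kp].
case: pickP => [[[c d] q] /andP[/eqP E Jq] /=|none].
  rewrite leq_seq_min ?(joins_neq0 _ _ _ Jq) // all_map.
  have : c \in [set a; b] by rewrite E set21.
  rewrite !inE => /orP[]/eqP Ec; rewrite /= Ec in Jq.
    by rewrite -(trail_unique J Jq).
  by rewrite -(trail_unique (joins_rev J) Jq) all_rev.
have Up : uniq p by case/and3P: J.
have size_p : size p <= #|{: edge N}| by rewrite -(card_uniqP Up) max_card.
by have := none (a, b, Bseq size_p); rewrite /P /= eqxx J.
Qed.
End Unique.
End Picture.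

(** * The product by contractions *)

Definition drawn N (V : Type) (g : node N -> V) (C : labelling N) k (u v : V) :=
  exists a b, [/\ k <= C [set a; b], u = g a & v = g b].

Lemma linked_strand (T : eqType) pos (live : pred T) f l
    (glue : T -> T -> Prop) k p q :
  planar pos live f l -> (forall u v, ~ glue u v) ->
  linked (union _ (strand live f l k) glue) p q ->
  p = q \/ strand live f l k p q.
Proof.
move=> Pf no_glue.
elim=> {p q}[u v [|/no_glue//]|u|u v _ [->|[Lu -> klu]]|u v w].
- by right.
- by left.
- by left.
- right; split; first exact: planar_live Pf _ Lu.
    by rewrite (planar_inv Pf).
  by rewrite (planar_label Pf).
move=> _ [->|[Lu -> klu]] _ // [<-|[Lv -> klv]]; first by right.
by left; rewrite (planar_inv Pf).
Qed.

Section Gluing.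
Variables (N : nat) (C D : labelling N) (F G : node N -> node N).
Hypotheses (mC : matched_by C F) (mD : matched_by D G).
Hypotheses (pC : planar_mate C F) (pD : planar_mate D G).

Lemma linkP k u v : 0 < k -> link C D k u v <->
  union _ (drawn (@left_vertex N) C k) (drawn (@right_vertex N) D k) u v.
Proof.
have imset2 (g : node N -> vertex N) a b : g @: [set a; b] = [set g a; g b].
  by rewrite imsetU1 imset_set1.
have side (g : node N -> vertex N) E H : matched_by E H -> 0 < k ->
    forall A, k <= E A -> g @: A == [set u; v] -> drawn g E k u v.
  move=> mE k_gt0 A kA; have [a EA] := mate_arc mE (leq_trans k_gt0 kA).
  rewrite EA imset2 => /eqP Euv; have : u \in [set g a; g (H a)].
    by rewrite Euv set21.
  rewrite !inE => /orP[]/eqP Eu; rewrite Eu in Euv *.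
    by exists a, (H a); rewrite -EA (set2_injr Euv).
  exists (H a), a; rewrite setUC -EA; split=> //.
  by apply/esym/(set2_injr (a := g (H a))); rewrite -Euv setUC.
move=> k_gt0; split.
  case/existsP=> [[A|A]] /andP[kA Euv].
    by left; apply: side mC k_gt0 A kA Euv.
  by right; apply: side mD k_gt0 A kA Euv.
case=> [[a [b [kab -> ->]]]|[a [b [kab -> ->]]]]; apply/existsP.
  by exists (inl [set a; b]); rewrite /= kab imset2 /=.
by exists (inr [set a; b]); rewrite /= kab imset2 /=.
Qed.

Definition line : eqType := (node N + node N)%type.
Implicit Types (p q : line) (a b : node N).

Definition lpos p : nat :=
  match p with inl a => npos a | inr a => N + N + npos a end.

Lemma lpos_inj : injective lpos.
Proof.
case=> a [] b /= E; have := npos_lt a; have := npos_lt b => *.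
- by congr inl; apply: npos_inj.
- lia.
- lia.
- by congr inr; apply: npos_inj; lia.
Qed.

Definition line_mate p : line :=
  match p with inl a => inl (F a) | inr a => inr (G a) end.
Definition line_label p : nat :=
  match p with inl a => mate_label C F a | inr a => mate_label D G a end.

(** After [t] steps the nodes [bar 1, ..., bar t] of the left diagram and
    [1, ..., t] of the right one have disappeared. *)
Definition unglued t p : bool :=
  match p with inl (inr i) | inr (inl i) => t <= i | _ => true end.
Definition glue t p q : Prop :=
  exists i : 'I_N, [/\ t <= i, p = inl (inr i) & q = inr (inl i)].

Lemma far a z : (N + N + z < npos a) = false.
Proof. by have := npos_lt a; lia. Qed.

Lemma near a z : npos a < N + N + z.
Proof. by rewrite ltn_addr ?npos_lt. Qed.

Lemma planar_line : planar lpos (unglued 0) line_mate line_label.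
Proof.
split.
- by case=> a _ /=; [case: (F a)|case: (G a)].
- by case=> a _ /=; rewrite ?(mate_inv mC) ?(mate_inv mD).
- case=> a _ /=; [exact: (mate_neq mC)|exact: (mate_neq mD)].
- case=> a _ /=; [exact: (planar_label pC)|exact: (planar_label pD)].
- case=> a _ /=; [exact: (mate_gt0 mC)|exact: (mate_gt0 mD)].
case=> a [] b _ _ /=.
- exact: (planar_nc pC).
- by rewrite /between /= !near.
- by rewrite /between /= !far.
- move=> ba bGa.
  have := planar_nc pD (erefl : predT a) (erefl : predT b) ba bGa.
  by rewrite /between /= !ltn_add2l.
Qed.

Lemma okada_line : okada_mate C F -> okada_mate D G ->
  okada_labels lpos (unglued 0) line_mate line_label.
Proof.
move=> oC oD; split.
  case=> a [] b _ _; rewrite /between /=.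
  - exact: (okada_nest oC).
  - by rewrite !near.
  - by rewrite !far.
  - rewrite !ltn_add2l; exact: (okada_nest oD).
case=> a _ /=; first exact: (okada_parity oC).
by rewrite ltn_add2l !oddD addbb; exact: (okada_parity oD).
Qed.

(** Gluing from the middle of the line outwards keeps the two points to be
    identified next to each other. *)
Lemma gluing t : t <= N -> exists f l,
  [/\ planar lpos (unglued t) f l,
      okada_mate C F -> okada_mate D G -> okada_labels lpos (unglued t) f l,
      forall p, unglued t p -> l p <= line_label p
    & forall k p q, unglued t p -> unglued t q ->
        linked
          (union _ (strand (unglued 0) line_mate line_label k) (glue 0)) p q
        <-> linked (union _ (strand (unglued t) f l k) (glue t)) p q].
Proof.
elim: t => [|t IH] tN.
  exists line_mate, line_label; split=> //.
  - exact: planar_line.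
  - exact: okada_line.
have [f [l [Pf Of lf link_f]]] := IH (ltnW tN).
pose i := Ordinal tN.
pose x : line := inl (inr i); pose y : line := inr (inl i).
have Lx : unglued t x by apply: leqnn.
have Ly : unglued t y by apply: leqnn.
have lt_xy : lpos x < lpos y by rewrite /=; lia.
have odd_xy : odd (lpos y) = ~~ odd (lpos x) by rewrite /=; lia.
have adj_xy z : unglued t z -> z != x -> z != y ->
    (lpos x < lpos z) = (lpos y < lpos z).
  rewrite -!(inj_eq lpos_inj) /lpos /=.
  case: z => [[j|j]|[j|j]] /=; have := ltn_ord j; lia.
have liveE z : unglued t.+1 z = [&& unglued t z, z != x & z != y].
  rewrite -!(inj_eq lpos_inj) /lpos /=.
  case: z => [[j|j]|[j|j]] /=; have := ltn_ord j; lia.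
have L'W z : unglued t.+1 z -> unglued t z by rewrite liveE => /andP[].
exists (splice f x y), (splice_label f l x y); split.
- exact: (planar_splice lpos_inj Pf Lx Ly lt_xy adj_xy liveE).
- move=> oC oD; have := Of oC oD.
  exact: (okada_splice lpos_inj Pf Lx Ly lt_xy adj_xy odd_xy liveE).
- move=> p L'p; have Lp := L'W p L'p.
  case: (spliceP Pf Lx Ly lt_xy liveE L'p) => [Ep _ _ _|Ep _ _ _|_ _ _ _].
  + by apply: leq_trans (lf p Lp); rewrite Ep (planar_label Pf) ?geq_minl.
  + by apply: leq_trans (lf p Lp); rewrite Ep (planar_label Pf) ?geq_minr.
  + exact: lf.
- move=> k p q L'p L'q; rewrite link_f ?L'W //.
  apply: (linked_splice Pf Lx Ly lt_xy liveE) => // u v; last first.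
    by case=> j [tj -> ->]; rewrite -!(inj_eq lpos_inj) /=; have := ltn_ord j;
       split; lia.
  split=> [[j [tj -> ->]]|[[j [tj -> ->]]|[-> ->]]].
  + have [Etj|ltj] := eqVneq t j; last first.
      by left; exists j; rewrite ltn_neqAle ltj.
    by right; rewrite /x /y; have -> : j = i by apply: ord_inj.
  + by exists j; rewrite ltnW.
  + by exists i.
Qed.

Definition outer a : line :=
  match a with inl i => inl (inl i) | inr i => inr (inr i) end.
(** The left inverse of [outer]; its values at glued points are arbitrary. *)
Definition inner p : node N :=
  match p with
  | inl (inl i) | inr (inl i) => inl i
  | inl (inr i) | inr (inr i) => inr i
  end.

Lemma outerK a : inner (outer a) = a.
Proof. by case: a. Qed.

Lemma innerK p : unglued N p -> outer (inner p) = p.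
Proof. by case: p => [[i|i]|[i|i]] //=; rewrite leqNgt ltn_ord. Qed.

Lemma unglued_outer t a : unglued t (outer a).
Proof. by case: a. Qed.

Definition vertex_of p : vertex N :=
  match p with inl a => left_vertex a | inr a => right_vertex a end.
Definition point_of (v : vertex N) : line :=
  match v with
  | inl (inl i) => inl (inl i) | inl (inr i) => inr (inr i)
  | inr i => inl (inr i)
  end.

Lemma link_line k a b : 0 < k ->
  linked (link C D k) (inl a) (inl b) <->
  linked (union _ (strand (unglued 0) line_mate line_label k) (glue 0))
    (outer a) (outer b).
Proof.
move=> k_gt0; set r := union _ _ _.
have vertex_outer c : vertex_of (outer c) = inl c by case: c.
have point_outer c : point_of (inl c) = outer c by case: c.
split; last first.
  rewrite -!vertex_outer; apply: linked_map => p q.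
  case=> [[_ -> ]|[i [_ -> ->]]]; last exact: rst_refl.
  case: p => c kc; apply/rst_step/linkP => //; [left|right].
    by exists c, (F c).
  by exists c, (G c).
have glue_right c : linked r (point_of (right_vertex c)) (inr c).
  case: c => i /=; last exact: rst_refl.
  by apply: rst_step; right; exists i.
have strand_r p : k <= line_label p -> linked r p (line_mate p).
  by move=> kp; apply: rst_step; left; split=> //; case: p kp => [[i|i]|[i|i]].
rewrite -!point_outer; apply: linked_map => u v /(linkP _ _ k_gt0).
case=> [[c [d [kcd -> ->]]]|[c [d [kcd -> ->]]]].
  have point_left e : point_of (left_vertex e) = inl e by case: e.
  have Ed := arc_mate mC (leq_trans k_gt0 kcd); rewrite Ed in kcd *.
  by rewrite !point_left; apply: (strand_r (inl c)).
apply: rst_trans (glue_right c) _.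
apply: rst_trans (rst_sym _ _ _ _ (glue_right d)).
have Ed := arc_mate mD (leq_trans k_gt0 kcd); rewrite Ed in kcd *.
exact: (strand_r (inr c)).
Qed.

(** What is left on the line after all the contractions is the product. *)
Lemma product_mate : exists H,
  [/\ matched_by (labelled_product C D) H,
      planar_mate (labelled_product C D) H,
      okada_mate C F -> okada_mate D G -> okada_mate (labelled_product C D) H
    & forall a, mate_label (labelled_product C D) H a <= line_label (outer a)].
Proof.
have [f [l [Pf Of lf link_f]]] := gluing (leqnn N).
pose H a := inner (f (outer a)); pose L a := l (outer a).
have outerH a : outer (H a) = f (outer a).
  by rewrite innerK // (planar_live Pf) ?unglued_outer.
have outer_inj : injective outer := can_inj outerK.
have no_glue u v : ~ glue N u v by case=> i [+ _ _]; rewrite leqNgt ltn_ord.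
have productE k a b : 0 < k ->
    k <= labelled_product C D [set a; b] <-> b = H a /\ k <= L a.
  move=> k_gt0.
  rewrite (leq_product mC mD) // link_line // link_f ?unglued_outer //.
  split=> [[ab /(linked_strand Pf no_glue)[/outer_inj Eab|[_ Eb kl]]]|[-> kl]].
  - by rewrite Eab eqxx in ab.
  - by split=> //; apply: outer_inj; rewrite outerH.
  split; last by apply: rst_step; left; split; rewrite ?unglued_outer.
  by rewrite -(inj_eq outer_inj) outerH eq_sym (planar_neq Pf) ?unglued_outer.
have HL a : labelled_product C D [set a; H a] = L a.
  apply: eq_from_leq => k /productE P; apply/idP/idP => [/P[]//|kL]; exact/P.
have HK : involutive H.
  by move=> a; rewrite {1}/H outerH (planar_inv Pf) ?unglued_outer ?outerK.
have mH : matched_by (labelled_product C D) H.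
  split=> //.
  - move=> a.
    by rewrite -(inj_eq outer_inj) outerH (planar_neq Pf) ?unglued_outer.
  - by move=> a; rewrite HL (planar_gt0 Pf) ?unglued_outer.
  move=> A A_gt0; suff [a [b EA]] : exists a b, A = [set a; b].
    by exists a; move: A_gt0; rewrite EA => /productE[]// ->.
  move: A_gt0; rewrite ffunE; case: pickP => // -[[a b] p] /andP[/eqP EA _] _.
  by exists a, b.
have lposE a b : (lpos (outer a) < lpos (outer b)) = (npos a < npos b).
  by case: a b => i [] j /=; have := ltn_ord i; have := ltn_ord j; lia.
have odd_lpos a : odd (lpos (outer a)) = odd (npos a).
  by case: a => i //=; rewrite !oddD addbb.
have LE a : mate_label (labelled_product C D) H a = L a by apply: HL.
exists H; split=> //.
- split=> //; try by case: mH.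
  + by move=> a _; rewrite !LE /L outerH (planar_label Pf) ?unglued_outer.
  + by move=> a _; rewrite LE (planar_gt0 Pf) ?unglued_outer.
  move=> a b _ _; rewrite -!(inj_eq outer_inj) outerH => ba bHa.
  have := planar_nc Pf (unglued_outer N a) (unglued_outer N b) ba bHa.
  by rewrite /between -!outerH !lposE.
- move=> oC oD; have oH := Of oC oD; split.
    move=> a b _ _; rewrite -!(inj_eq outer_inj) outerH => ba bHa.
    rewrite !LE /between -!lposE outerH.
    exact: okada_nest oH _ _ (unglued_outer N a) (unglued_outer N b) ba bHa.
  move=> a _; rewrite LE -lposE -odd_lpos outerH.
  exact: okada_parity oH _ (unglued_outer N a).
- by move=> a; rewrite LE; apply/lf/unglued_outer.
Qed.
End Gluing.

(** * Associativity *)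

Lemma eq_labelling N (C D : labelling N) F G :
  matched_by C F -> matched_by D G ->
  (forall k a b, 0 < k -> k <= C [set a; b] <-> k <= D [set a; b]) -> C = D.
Proof.
move=> mC mD H; apply/ffunP => A; apply: eq_from_leq => k k_gt0.
apply/idP/idP => kA.
  have [a E] := mate_arc mC (leq_trans k_gt0 kA).
  by rewrite E in kA *; apply/H.
have [a E] := mate_arc mD (leq_trans k_gt0 kA).
by rewrite E in kA *; apply/H.
Qed.

Section Columns.
Variable N : nat.
Implicit Types (C D E : labelling N) (F G H : node N -> node N) (a b : node N).

(** The [j]-th diagram of a product of several ones is drawn between the columns
    [j] and [j + 1], and a product of consecutive ones between the extreme
    columns, so that all the partial products live in the same picture. *)
Definition place (c d : nat) a : nat * 'I_N :=
  match a with inl i => (c, i) | inr i => (d, i) end.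

Definition span c d C k := drawn (place c d) C k.

Lemma spanW c d C k u v : span c d C k u v ->
  (u.1 = c \/ u.1 = d) /\ (v.1 = c \/ v.1 = d).
Proof.
case=> a [b [_ -> ->]].
by split; [case: a|case: b] => i; [left|right|left|right].
Qed.

Lemma leq_product_span C D F G c d e k a b : matched_by C F -> matched_by D G ->
  uniq [:: c; d; e] -> 0 < k ->
  k <= labelled_product C D [set a; b] <->
  a != b /\ linked (union _ (span c d C k) (span d e D k))
              (place c e a) (place c e b).
Proof.
move=> mC mD; rewrite /= !inE negb_or andbT => /andP[/andP[cd ce] de] k_gt0.
rewrite (leq_product mC mD) //.
pose g (v : vertex N) :=
  match v with inl x => place c e x | inr i => (d, i) end.
have g_inj : injective g.
  case=> [[i|i]|i] [[j|j]|j] [] // *;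
    first [by congruence | by subst; rewrite ?eqxx in cd ce de].
have g_left x : place c d x = g (left_vertex x) by case: x.
have g_right x : place d e x = g (right_vertex x) by case: x.
suff -> : linked (link C D k) (inl a) (inl b) <->
    linked (union _ (span c d C k) (span d e D k))
      (g (inl a)) (g (inl b)) by [].
split.
  apply: linked_map => u v /(linkP mC mD _ _ k_gt0).
  case=> [[x [y [kxy -> ->]]]|[x [y [kxy -> ->]]]]; apply: rst_step.
    by left; exists x, y; rewrite -!g_left.
  by right; exists x, y; rewrite -!g_right.
apply: linked_inj g_inj _ => u v [] [x [y [kxy -> ->]]].
  exists (left_vertex x), (left_vertex y); rewrite !g_left; split=> //.
  by apply/(linkP mC mD) => //; left; exists x, y.
exists (right_vertex x), (right_vertex y); rewrite !g_right; split=> //.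
by apply/(linkP mC mD) => //; right; exists x, y.
Qed.

(** In a picture that meets column [d] only through [C] and [D], drawing their
    product instead of them does not change the connections between the
    other columns. *)
Lemma linked_product C D F G c d e k
    (A : nat * 'I_N -> nat * 'I_N -> Prop) u v :
  matched_by C F -> matched_by D G -> uniq [:: c; d; e] -> 0 < k ->
  (forall x y, A x y -> x.1 != d /\ y.1 != d) -> u.1 != d -> v.1 != d ->
  linked (union _ A (span c e (labelled_product C D) k)) u v <->
  linked (union _ A (union _ (span c d C k) (span d e D k))) u v.
Proof.
move=> mC mD cde k_gt0 Ad ud vd.
apply: (@linked_hide _ (fun x => x.1 != d)) => //.
  move=> x y [a [b [kab -> ->]]].
  by have [] := (leq_product_span a b mC mD cde k_gt0).1 kab.
move=> x y xd yd xy.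
have [|->|[Px Py]] := linked_support (P := fun x => x.1 \in [:: c; d; e]) _ xy.
- by move=> s t [] /spanW[[->|->] [->|->]]; rewrite !inE !eqxx ?orbT.
- exact: rst_refl.
have at_end z : z.1 != d -> z.1 \in [:: c; d; e] -> exists a, z = place c e a.
  case: z => z i /=; rewrite !inE => /negPf-> /orP[|] /eqP->.
    by exists (inl i).
  by exists (inr i).
have [a Ea] := at_end x xd Px; have [b Eb] := at_end y yd Py; subst x y.
have [->|ab] := eqVneq a b; first exact: rst_refl.
apply: rst_step; exists a, b; split=> //.
exact/(leq_product_span a b mC mD cde k_gt0).
Qed.

Lemma labelled_productA C D E :
  labelled_arc_diagram C -> labelled_arc_diagram D -> labelled_arc_diagram E ->
  labelled_product C (labelled_product D E)
  = labelled_product (labelled_product C D) E.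
Proof.
case/labelled_arc_diagramP=> F mC pC /labelled_arc_diagramP[G mD pD].
case/labelled_arc_diagramP=> H mE pE.
have [FG [mCD pCD _ _]] := product_mate mC mD pC pD.
have [GH [mDE pDE _ _]] := product_mate mD mE pD pE.
have [L [mL _ _ _]] := product_mate mC mDE pC pDE.
have [R [mR _ _ _]] := product_mate mCD mE pCD pE.
apply: (eq_labelling mL mR) => k a b k_gt0.
rewrite (leq_product_span (c := 0) (d := 1) (e := 3) a b mC mDE) //.
rewrite (leq_product_span (c := 0) (d := 2) (e := 3) a b mCD mE) //.
have col x : (place 0 3 x).1 != 1 /\ (place 0 3 x).1 != 2 by case: x.
have [[a1 a2] [b1 b2]] := (col a, col b).
have swap (r s : nat * 'I_N -> nat * 'I_N -> Prop) u v :
  linked (union _ r s) u v <-> linked (union _ s r) u v.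
  by apply: linked_eq => x y; split=> [] []; by [left|right].
have colW c d e X x y : c != e -> d != e ->
    span c d X k x y -> x.1 != e /\ y.1 != e.
  by move=> ce de /spanW[[->|->] [->|->]].
rewrite (linked_product (d := 2) mD mE) //; last by move=> x y; apply: colW.
rewrite (swap (span 0 2 _ _)) (linked_product (d := 1) mC mD) //; last first.
  by move=> x y; apply: colW.
suff -> : linked
      (union _ (span 0 1 C k) (union _ (span 1 2 D k) (span 2 3 E k)))
    (place 0 3 a) (place 0 3 b) <->
  linked (union _ (span 2 3 E k) (union _ (span 0 1 C k) (span 1 2 D k)))
    (place 0 3 a) (place 0 3 b) by [].
by apply: linked_eq => x y; rewrite /union; tauto.
Qed.
End Columns.

(** * The identity diagram *)

Section Identity.
Variable N : nat.
Implicit Types (C : labelling N) (F : node N -> node N) (a b : node N).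

Definition bar a : node N := match a with inl i => inr i | inr i => inl i end.

Lemma id_bar a : id_diagram N [set a; bar a] = absn a.
Proof.
pose height := match a with inl i | inr i => i end.
rewrite ffunE; case: pickP => [i /eqP|/(_ height)].
  by case: (a) => j /setP/(_ (inl i));
    rewrite !inE /= eqxx ?orbF => /eqP[->].
by rewrite /height; case: (a) => i /=; rewrite 1?setUC eqxx.
Qed.

Lemma id_matched : matched_by (id_diagram N) bar.
Proof.
split; try by case.
  by move=> a; rewrite id_bar; case: a.
move=> A; rewrite ffunE; case: pickP => // i /eqP-> _; by exists (inl i).
Qed.

Lemma id_planar : planar_mate (id_diagram N) bar.
Proof.
apply/(non_crossingP id_matched) => a b c d.
rewrite !inE => /(arc_mate id_matched)-> /(arc_mate id_matched)-> [].
rewrite !precE.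
by case: a c => i [] j /=; have := ltn_ord i; have := ltn_ord j; lia.
Qed.

Lemma id_okada : okada_diagram (id_diagram N).
Proof.
apply/(okada_diagramP id_matched id_planar); split; last first.
  by move=> a; rewrite /mate_label id_bar.
split=> [a b _ _|a _]; rewrite /mate_label !id_bar /between.
  rewrite -!(inj_eq (@npos_inj N)).
  case: a b => i [] j /=; have := ltn_ord i; have := ltn_ord j;
    by do 2!case: ltnP; lia.
by case: a => i /=; have := ltn_ord i; case: ltnP; lia.
Qed.

(** The arcs of a matching are disjoint, so they cannot be chained. *)
Lemma linked_arcs C F k a b : matched_by C F -> 0 < k ->
  linked (drawn id C k) a b -> a = b \/ k <= C [set a; b].
Proof.
move=> mC k_gt0; have FK := mate_inv mC.
elim=> {a b}[a b [c [d [kcd -> ->]]]|a|a b _ [->|kab]|a b c _ IH1 _ IH2].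
- by right.
- by left.
- by left.
- by right; rewrite setUC.
case: IH1 => [->//|kab]; case: IH2 => [<-|kbc]; first by right.
left; rewrite (arc_mate mC (leq_trans k_gt0 kbc)).
by rewrite (arc_mate mC (leq_trans k_gt0 kab)) FK.
Qed.

(** Collapsing the arcs of [id_diagram] maps the picture of the product to [C].
    Conversely an arc of [C] with label at least [k] that ends at a left node of
    height [i] is prolonged by the arc of [id_diagram] at this height, whose
    label [i] is at least [k] by the bound on the labels of [C]. *)
Lemma okada_id_product C : okada_diagram C ->
  labelled_product (id_diagram N) C = C.
Proof.
move=> oC; have [/labelled_arc_diagramP[F mC pC] _ _ _] := oC.
have [_ bd] := (okada_diagramP mC pC).1 oC.
have [H [mH _ _ _]] := product_mate id_matched mC id_planar pC.
apply: (eq_labelling mH mC) => k a b k_gt0.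
rewrite (leq_product id_matched mC) //.
split=> [[ab ab_k]|kab].
  have [//|E|//] := @linked_arcs C F k a b mC k_gt0.
    pose g (v : vertex N) := match v with inl x => x | inr i => inl i end.
    apply: (linked_map (g := g)) ab_k => u v /(linkP id_matched mC _ _ k_gt0).
    case=> [[x [y [kxy -> ->]]]|[x [y [kxy -> ->]]]].
      have -> := arc_mate id_matched (leq_trans k_gt0 kxy).
      by case: (x) => i; apply: rst_refl.
    by apply: rst_step; exists x, y; split; by [|case: (x)|case: (y)].
  by rewrite E eqxx in ab.
have Eb := arc_mate mC (leq_trans k_gt0 kab).
split; first by rewrite Eb eq_sym (mate_neq mC).
have enter c d : k <= C [set c; d] ->
    linked (link (id_diagram N) C k) (inl c) (right_vertex c).
  case: c => i kc; last exact: rst_refl.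
  apply/rst_step/(linkP id_matched mC) => //; left; exists (inl i), (inr i).
  split=> //; rewrite (id_bar (inl i)) (leq_trans kc) //.
  rewrite (arc_mate mC (leq_trans k_gt0 kc)); exact: (bd (inl i)).
apply: rst_trans (enter a b kab) _.
apply: rst_trans (rst_sym _ _ _ _ (enter b a _)); last by rewrite setUC.
by apply/rst_step/(linkP id_matched mC) => //; right; exists a, b.
Qed.

Lemma okada_product_id C : okada_diagram C ->
  labelled_product C (id_diagram N) = C.
Proof.
move=> oC; have [/labelled_arc_diagramP[F mC pC] _ _ _] := oC.
have [_ bd] := (okada_diagramP mC pC).1 oC.
have [H [mH _ _ _]] := product_mate mC id_matched pC id_planar.
apply: (eq_labelling mH mC) => k a b k_gt0.
rewrite (leq_product mC id_matched) //.
split=> [[ab ab_k]|kab].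
  have [//|E|//] := @linked_arcs C F k a b mC k_gt0.
    pose g (v : vertex N) := match v with inl x => x | inr i => inr i end.
    apply: (linked_map (g := g)) ab_k => u v /(linkP mC id_matched _ _ k_gt0).
    case=> [[x [y [kxy -> ->]]]|[x [y [kxy -> ->]]]].
      by apply: rst_step; exists x, y; split; by [|case: (x)|case: (y)].
    have -> := arc_mate id_matched (leq_trans k_gt0 kxy).
    by case: (x) => i; apply: rst_refl.
  by rewrite E eqxx in ab.
have Eb := arc_mate mC (leq_trans k_gt0 kab).
split; first by rewrite Eb eq_sym (mate_neq mC).
have enter c d : k <= C [set c; d] ->
    linked (link C (id_diagram N) k) (inl c) (left_vertex c).
  case: c => i kc; first exact: rst_refl.
  apply/rst_step/(linkP mC id_matched) => //; right; exists (inr i), (inl i).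
  split=> //; rewrite (id_bar (inr i)) (leq_trans kc) //.
  rewrite (arc_mate mC (leq_trans k_gt0 kc)); exact: (bd (inr i)).
apply: rst_trans (enter a b kab) _.
apply: rst_trans (rst_sym _ _ _ _ (enter b a _)); last by rewrite setUC.
by apply/rst_step/(linkP mC id_matched) => //; left; exists a, b.
Qed.
End Identity.

(** * The monoid of Okada diagrams *)

Lemma labelled_product_diagram N (C D : labelling N) :
  labelled_arc_diagram C -> labelled_arc_diagram D ->
  labelled_arc_diagram (labelled_product C D).
Proof.
case/labelled_arc_diagramP=> F mC pC /labelled_arc_diagramP[G mD pD].
have [H [mH pH _ _]] := product_mate mC mD pC pD.
by apply/labelled_arc_diagramP; exists H.
Qed.

Lemma labelled_product_okada N (C D : labelling N) :
  okada_diagram C -> okada_diagram D -> okada_diagram (labelled_product C D).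
Proof.
move=> okC okD.
have [/labelled_arc_diagramP[F mC pC] _ _ _] := okC.
have [/labelled_arc_diagramP[G mD pD] _ _ _] := okD.
have [oC bdC] := (okada_diagramP mC pC).1 okC.
have [oD bdD] := (okada_diagramP mD pD).1 okD.
have [H [mH pH oH bdH]] := product_mate mC mD pC pD.
apply/(okada_diagramP mH pH); split; first exact: oH.
by move=> a; apply: leq_trans (bdH a) _; case: a => i; [apply: bdC|apply: bdD].
Qed.

Theorem theorem3p43 (N : nat) :
  subsemigroup (@okada_diagram N) (@labelled_arc_diagram N)
    (@labelled_product N)
  /\ monoid_on (@okada_diagram N) (@labelled_product N) (id_diagram N).
Proof.
have arcW (C : labelling N) : okada_diagram C -> labelled_arc_diagram C by case.
split; split.
- split; [exact: labelled_product_diagram|exact: labelled_productA].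
- exact: arcW.
- exact: labelled_product_okada.
- split; first exact: labelled_product_okada.
  by move=> C D E /arcW ? /arcW ? /arcW ?; apply: labelled_productA.
- exact: id_okada.
- exact: okada_id_product.
- exact: okada_product_id.
Qed.
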